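(* For all $k,l\in\mathbb{N}=\{0,1,2,\dots\}$, let $$Y_{k,l}=(A_k\odot A_l)\cdot(B_k\odot B_l)\quad\text{and}\quad Z_{k,l}=(A_l\odot B_k)\cdot(B_l\odot A_k).$$ Then $Y_{k,l}$ and $Z_{k,l}$, seen as unrooted trees, are not isomorphic, satisfy $U_{k+l+2}(Y_{k,l})=U_{k+l+2}(Z_{k,l})$, and satisfy $U_{k+l+3}(Y_{k,l})\neq U_{k+l+3}(Z_{k,l})$.
   Context: All trees are finite. A rooted graph is a pair $(G,v_0)$ with $G$ a graph and $v_0$ a vertex of $G$, called the root. Joinings: for rooted graphs $(G,v)$ and $(H,v')$, $G\odot H$ is the rooted graph obtained from the disjoint union of $G$ and $H$ by identifying $v$ and $v'$, with the identified vertex as root. $G\cdot H$ is the rooted graph obtained from the disjoint union of $G$ and $H$ by adding an edge between $v$ and $v'$ and declaring $v$ (the root of $G$) to be the root. The trees $A_k,B_k$: $A_0$ is the path on three vertices rooted at its central vertex; $B_0$ is the path on three vertices rooted at one of its leaves; for $k\ge 1$, $A_k:=A_{k-1}\cdot B_{k-1}$ and $B_k:=B_{k-1}\cdot A_{k-1}$. The restricted $U$-polynomial: let $x_1,x_2,\dots$ be commuting indeterminates. For a tree $T=(V,E)$ with $n$ vertices and $A\subseteq E$, let $\lambda(A)$ be the partition of $n$ whose parts are the numbers of vertices of the connected components of the spanning subgraph $(V,A)$, and for a partition $\lambda=(\lambda_1,\dots,\lambda_s)$ put $\mathbf{x}_\lambda=x_{\lambda_1}\cdots x_{\lambda_s}$.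 The $U$-polynomial of $T$ is $U(T)=\sum_{A\subseteq E}\mathbf{x}_{\lambda(A)}$. For an integer $k\ge 0$, $U_k(T)$ is the polynomial obtained from $U(T)$ by keeping exactly the terms of total degree at most $k+1$ in the $x_i$, i.e. $U_k(T)=\sum_{A\subseteq E,\ |A|\ge n-k-1}\mathbf{x}_{\lambda(A)}$. *)

(* Defs.v *)
From HB Require Import structures.
From mathcomp Require Import all_boot.
From mathcomp Require Import ssralg ssrint.
From mathcomp Require Import finmap monalg.

Set Implicit Arguments.
Unset Strict Implicit.
Unset Printing Implicit Defensive.

Import GRing.Theory.
Local Open Scope ring_scope.

Record sgraph := SGraph {
  vertex :> finType;
  adj : rel vertex;
  adj_sym : symmetric adj;
  adj_irr : irreflexive adj
}.

Record rgraph := RGraph { unrooted :> sgraph; root : unrooted }.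

Definition isomorphic (G H : sgraph) : Prop :=
  exists f : G -> H,
    bijective f /\ (forall x y : G, adj (f x) (f y) = adj x y).

(* The vertices of the path on n vertices are numbered along the path. *)
Section Path.
Variable n : nat.

Definition path_adj : rel 'I_n :=
  [rel i j : 'I_n | (i.+1 == j :> nat) || (j.+1 == i :> nat)].

Lemma path_adj_sym : symmetric path_adj.
Proof. by move=> i j; rewrite /path_adj /= orbC. Qed.

Lemma path_adj_irr : irreflexive path_adj.
Proof. by move=> i; rewrite /path_adj /= orbb gtn_eqF. Qed.

Definition path_graph : sgraph := SGraph path_adj_sym path_adj_irr.

End Path.

Section Joinings.
Variables G H : rgraph.

(* The identified vertex is represented by the root of G, so the other
   vertices coming from H are those distinct from the root of H. *)
Definition odot_vertex : finType := (G + {x : H | x != root H})%type.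

Definition odot_adj : rel odot_vertex := fun u v =>
  match u, v with
  | inl x, inl y => adj x y
  | inr x, inr y => adj (val x) (val y)
  | inl x, inr y => (x == root G) && adj (root H) (val y)
  | inr x, inl y => (y == root G) && adj (root H) (val x)
  end.

Lemma odot_adj_sym : symmetric odot_adj.
Proof. by move=> [x|x] [y|y] //=; rewrite adj_sym. Qed.

Lemma odot_adj_irr : irreflexive odot_adj.
Proof. by move=> [x|x] /=; rewrite adj_irr. Qed.

Definition odot : rgraph :=
  @RGraph (SGraph odot_adj_sym odot_adj_irr) (inl (root G)).

Definition cdot_vertex : finType := (G + H)%type.

Definition cdot_adj : rel cdot_vertex := fun u v =>
  match u, v with
  | inl x, inl y => adj x y
  | inr x, inr y => adj x y
  | inl x, inr y => (x == root G) && (y == root H)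
  | inr x, inl y => (x == root H) && (y == root G)
  end.

Lemma cdot_adj_sym : symmetric cdot_adj.
Proof. by move=> [x|x] [y|y] //=; rewrite (adj_sym, andbC). Qed.

Lemma cdot_adj_irr : irreflexive cdot_adj.
Proof. by move=> [x|x] /=; rewrite adj_irr. Qed.

Definition cdot : rgraph :=
  @RGraph (SGraph cdot_adj_sym cdot_adj_irr) (inl (root G)).

End Joinings.

Definition A0 : rgraph := @RGraph (path_graph 3) (@Ordinal 3 1 isT).
Definition B0 : rgraph := @RGraph (path_graph 3) (@Ordinal 3 0 isT).

Fixpoint A_ (k : nat) : rgraph :=
  if k is k'.+1 then cdot (A_ k') (B_ k') else A0
with B_ (k : nat) : rgraph :=
  if k is k'.+1 then cdot (B_ k') (A_ k') else B0.

Definition Y (k l : nat) : rgraph :=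
  cdot (odot (A_ k) (A_ l)) (odot (B_ k) (B_ l)).
Definition Z (k l : nat) : rgraph :=
  cdot (odot (A_ l) (B_ k)) (odot (B_ l) (A_ k)).

(* Polynomials with integer coefficients in the indeterminates x_i, i : nat;
   the indeterminate x_0 never occurs in the polynomials below. *)
Definition upoly := {malg int[{cmonom nat}]}.

Definition x_ (i : nat) : upoly := << ucm i >>.

Section UPolynomial.
Variable G : sgraph.

Definition edges : {set {set G}} :=
  [set [set p.1; p.2] | p in [set p : G * G | adj p.1 p.2]].

Definition components (A : {set {set G}}) : {set {set G}} :=
  equivalence_partition (connect [rel x y : G | [set x; y] \in A]) [set: G].

(* lambda(A), with parts in nonincreasing order. *)
Definition component_sizes (A : {set {set G}}) : seq nat :=
  sort geq [seq #|C| | C : {set G} <- enum (components A)].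

Definition U : upoly :=
  \sum_(A : {set {set G}} | A \subset edges) \prod_(i <- component_sizes A) x_ i.

End UPolynomial.

Definition truncate (d : nat) (p : upoly) : upoly :=
  \sum_(m <- msupp p | (mdeg m <= d)%N) << p@_m *g m >>.

Definition Utrunc (k : nat) (G : sgraph) : upoly := truncate k.+1 (U G).

(* Main.v *)
From HB Require Import structures.
From mathcomp Require Import all_boot.
From mathcomp Require Import ssralg ssrint poly.
From mathcomp Require Import finmap monalg.
From mathcomp Require Import ring.
Require Import Defs.

Set Implicit Arguments.
Unset Strict Implicit.
Unset Printing Implicit Defensive.

Import GRing.Theory.
Local Open Scope ring_scope.

(** The U-polynomial is refined to rooted graphs: [rooted_U G] is a polynomial
    in one more indeterminate X, in which an edge set A contributes
    X^(c - 1) times the product of the x_i over the components of A that avoid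
    the root, c being the size of the component of the root.  The linear map
    [star], which sends X^n to x_(n+1), gives back U.  Not counting the root
    itself makes the joining at a common root multiplicative, and sorting the
    edge sets of a joining by an edge according to that edge gives the other
    rule:
      rooted_U (G odot H) = rooted_U G * rooted_U H,
      rooted_U (G cdot H) = rooted_U G * (X * rooted_U H + U H).

    Write a_k, b_k for the rooted polynomials of A_k, B_k.  The second rule
    shows that A_k and B_k have the same U-polynomial P_k and that
    a_k - b_k = P_0 ... P_(k-1) delta, with delta = a_0 - b_0 = x_1 X - x_2.
    With <f, g> = star (f g), the terms of U (Y k l) and U (Z k l) that come
    from edge sets containing the edge between the two halves agree, hence
      U (Y k l) - U (Z k l) = <a_k, a_l> <b_k, b_l> - <a_l, b_k> <b_l, a_k>
        = p q (<delta, delta> <b_k, b_l> - <delta, b_k> <delta, b_l>),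
    where p = P_0 ... P_(k-1) and q = P_0 ... P_(l-1) ([U_YZ]).

    All monomials of P_i have degree at least 1, those of <delta, f> at least
    2 and those of <delta, delta> at least 3; so the difference has no
    monomial of degree less than k + l + 4 ([order_ge_U_YZ]), which is the
    equality of the truncations.  This bound is sharp: set x_1 = 0 and all the
    other x_i = t.  Then delta becomes - t, <delta, delta> becomes 0 and
    <delta, b_k> becomes - t P_k, so that the difference becomes
    - p q t^2 P_k P_l; and P_i becomes t plus terms of higher order, since only
    the full edge set leaves a tree connected ([specialize_U_YZ]).  Hence the
    next truncations differ.  As U is an isomorphism invariant ([U_iso]), the
    trees are not isomorphic. *)

(** * Sums over the subsets of a union *)

Section SubsetSums.
Variable V : nmodType.

Lemma sum_subsetsU (T : finType) (E1 E2 : {set T}) (F : {set T} -> V) :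
  [disjoint E1 & E2] ->
  \sum_(A : {set T} | A \subset E1 :|: E2) F A =
  \sum_(A : {set T} | A \subset E1) \sum_(B : {set T} | B \subset E2)
     F (A :|: B).
Proof.
move=> dis; rewrite pair_big /=.
rewrite (reindex_onto (fun p : {set T} * {set T} => p.1 :|: p.2)
                      (fun D => (D :&: E1, D :&: E2))) /=; last first.
  by move=> D sD; rewrite -setIUr; apply/setIidPl.
apply: eq_bigl => -[A B] /=; rewrite subUset xpair_eqE !setIUl.
apply/idP/idP.
  case/andP=> _ /andP[/eqP eA /eqP eB].
  by apply/andP; split; [rewrite -{1}eA | rewrite -{1}eB]; rewrite -setIUl subsetIr.
case/andP=> sA sB.
have dAB : A :&: E2 = set0.
  by apply/eqP; rewrite setI_eq0; apply: disjointWl dis.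
have dBA : B :&: E1 = set0.
  by apply/eqP; rewrite setI_eq0 disjoint_sym; apply: disjointWr dis.
rewrite dAB dBA setU0 set0U (setIidPl sA) (setIidPl sB) !eqxx !andbT.
by rewrite (subset_trans sA) ?subsetUl // (subset_trans sB) ?subsetUr.
Qed.

Lemma sum_subsets_imset (T T' : finType) (f : T -> T') (E : {set T})
    (F : {set T'} -> V) :
  injective f ->
  \sum_(A : {set T'} | A \subset f @: E) F A =
  \sum_(A : {set T} | A \subset E) F (f @: A).
Proof.
move=> injf.
rewrite (reindex_onto (fun A : {set T} => f @: A)
                      (fun B : {set T'} => f @^-1: B)) /=; last first.
  move=> B /subsetP sB; apply/setP=> y; apply/imsetP/idP.
    by case=> x; rewrite inE => xB ->.
  by move=> yB; case/imsetP: (sB y yB) => x _ ey; exists x; rewrite // inE -ey.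
apply: eq_bigl => A.
have -> : f @^-1: (f @: A) = A by apply/setP=> x; rewrite inE mem_imset.
rewrite eqxx andbT; apply/subsetP/subsetP => sA x.
  by move=> xA; rewrite -(mem_imset _ _ injf); apply/sA/imset_f.
by case/imsetP=> y yA ->; apply/imset_f/sA.
Qed.

Lemma sum_subsets1 (T : finType) (b : T) (F : {set T} -> V) :
  \sum_(A : {set T} | A \subset [set b]) F A = F set0 + F [set b].
Proof.
rewrite (bigD1 set0) ?sub0set //= (bigD1 [set b]) /=; last first.
  by rewrite subxx; apply/set0Pn; exists b; rewrite set11.
rewrite big1 ?addr0 // => A /andP[/andP[+ +]].
by rewrite subset1 => /orP[] /eqP ->; rewrite eqxx.
Qed.

End SubsetSums.

(** * Components of an edge set *)

Definition image_sets (T T' : finType) (f : T -> T') (A : {set {set T}}) :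
  {set {set T'}} := [set f @: (e : {set T}) | e in A].

Section Components.
Variables (G : sgraph) (A : {set {set G}}).

Definition linked : rel G := connect [rel x y : G | [set x; y] \in A].

Definition component (x : G) : {set G} := [set y | linked x y].

Lemma linked_refl x : linked x x. Proof. exact: connect0. Qed.

Lemma linked_sym : symmetric linked.
Proof. by apply: sym_connect_sym => x y /=; rewrite setUC. Qed.

Lemma linked_trans : transitive linked.
Proof. exact: connect_trans. Qed.

Lemma linked1 x y : [set x; y] \in A -> linked x y.
Proof. by move=> xy; apply: connect1. Qed.

Lemma eq_linked x y z : linked x y -> linked x z = linked y z.
Proof.
move=> xy; apply/idP/idP; apply: linked_trans => //.
by rewrite linked_sym.
Qed.

(** Connectedness is the least preorder containing the edges; upper bounds on
    [linked] below are obtained by exhibiting a preorder. *)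
Lemma linked_min (S : rel G) :
  reflexive S -> transitive S ->
  (forall x y, [set x; y] \in A -> S x y) ->
  forall x y, linked x y -> S x y.
Proof.
move=> Srefl Strans AS x y /connectP[p pth ->] {y}.
elim: p x pth => [|z p IH] x /=; first by move=> _; apply: Srefl.
by case/andP=> /AS Sxz /IH; apply: Strans.
Qed.

Lemma mem_component x y : (y \in component x) = linked x y.
Proof. by rewrite inE. Qed.

Lemma componentsP C :
  reflect (exists x, C = component x) (C \in components A).
Proof.
apply: (iffP imsetP) => [[x _ ->]|[x ->]]; exists x => //;
  by apply/setP=> y; rewrite !inE.
Qed.

Lemma component_in x : component x \in components A.
Proof. by apply/componentsP; exists x. Qed.

Lemma component_id C x : C \in components A -> x \in C -> C = component x.
Proof.
case/componentsP=> y ->; rewrite inE => yx.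
by apply/setP=> z; rewrite !inE; apply: eq_linked.
Qed.

End Components.

Lemma linked_image (G K : sgraph) (f : G -> K) (A : {set {set G}})
    (D : {set {set K}}) x y :
  image_sets f A \subset D -> linked A x y -> linked D (f x) (f y).
Proof.
move=> sAD; move: x y.
apply: linked_min => [x|y x z|x y xy]; [exact: linked_refl | exact: linked_trans|].
apply/linked1/(subsetP sAD)/imsetP; exists [set x; y] => //.
by rewrite imsetU1 imset_set1.
Qed.

Lemma edgesP (G : sgraph) (e : {set G}) :
  reflect (exists x y, e = [set x; y] /\ adj x y) (e \in edges G).
Proof.
apply: (iffP imsetP) => [[[x y]]|[x [y [-> xy]]]].
  by rewrite inE /= => xy ->; exists x, y.
by exists (x, y); rewrite ?inE.
Qed.

Lemma set2_eq (T : finType) (a b c d : T) :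
  [set a; b] = [set c; d] -> (a = c /\ b = d) \/ (a = d /\ b = c).
Proof.
move=> /setP E; move: (E a) (E b) (E c) (E d); rewrite !inE !eqxx ?orbT /=.
do 4! [case: eqP => ?; subst => //=]; auto;
  do ?[case: eqP => ?; subst => //=]; auto.
Qed.

(** * The rooted U-polynomial *)

Section Weights.
Variable G : sgraph.

Definition monomial (A : {set {set G}}) : upoly :=
  \prod_(C in components A) x_ #|C|.

Lemma U_monomial : U G = \sum_(A : {set {set G}} | A \subset edges G) monomial A.
Proof.
apply: eq_bigr => A _; rewrite /component_sizes /monomial.
rewrite (perm_big [seq #|C| | C : {set G} <- enum (components A)]) ?perm_sort //=.
by rewrite big_map big_enum.
Qed.

(** The exponent does not count the root, which is shared when two graphs are
    joined at their roots. *)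
Definition rooted_monomial (A : {set {set G}}) (r : G) : {poly upoly} :=
  (\prod_(C in components A | r \notin C) x_ #|C|)
     *: 'X^(#|component A r|.-1).

End Weights.

Definition rooted_U (G : rgraph) : {poly upoly} :=
  \sum_(A : {set {set G}} | A \subset edges G) rooted_monomial A (root G).

(** Forgetting the root: X^n becomes x_(n+1), the root being counted again. *)
Definition star (p : {poly upoly}) : upoly := \sum_(i < size p) p`_i * x_ i.+1.

Lemma star_widen n (p : {poly upoly}) :
  (size p <= n)%N -> star p = \sum_(i < n) p`_i * x_ i.+1.
Proof.
move=> le_n; rewrite /star (big_ord_widen n (fun i => p`_i * x_ i.+1)) //.
rewrite big_mkcond; apply: eq_bigr => i _; case: ltnP => // ge_i.
by rewrite nth_default // mul0r.
Qed.

Lemma star_linear : linear_for *%R star.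
Proof.
move=> c p q; set n := maxn (size p) (size q).
rewrite (@star_widen n); last first.
  rewrite (leq_trans (size_polyD _ _)) // geq_max leq_maxr andbT.
  by rewrite (leq_trans (size_scale_leq _ _)) ?leq_maxl.
rewrite (@star_widen n p) ?leq_maxl // (@star_widen n q) ?leq_maxr //.
rewrite mulr_sumr -big_split /=; apply: eq_bigr => i _.
by rewrite coefD coefZ mulrDl -mulrA.
Qed.

HB.instance Definition _ := GRing.isLinear.Build upoly {poly upoly} upoly _ star
  star_linear.

Lemma starZ c p : star (c *: p) = c * star p.
Proof. exact: linearZ_LR. Qed.

Lemma star_sum I (s : seq I) (P : pred I) (F : I -> {poly upoly}) :
  star (\sum_(i <- s | P i) F i) = \sum_(i <- s | P i) star (F i).
Proof. exact: raddf_sum. Qed.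

Lemma starXn n : star 'X^n = x_ n.+1.
Proof.
rewrite (@star_widen n.+1) ?size_polyXn // big_ord_recr /= coefXn eqxx mul1r.
by rewrite big1 ?add0r // => i _; rewrite coefXn ltn_eqF ?mul0r ?ltn_ord.
Qed.

Lemma starB f g : star (f - g) = star f - star g.
Proof. exact: raddfB. Qed.

Lemma starD f g : star (f + g) = star f + star g.
Proof. exact: raddfD. Qed.

Lemma star_polyC c : star c%:P = c * x_ 1.
Proof. by rewrite -[c%:P]mulr1 mul_polyC starZ -(starXn 0). Qed.

Lemma starX : star 'X = x_ 2.
Proof. exact: (starXn 1). Qed.

Lemma star_rooted_U (G : rgraph) : star (rooted_U G) = U G.
Proof.
rewrite star_sum U_monomial; apply: eq_bigr => A _.
have r_in : root G \in component A (root G) by rewrite inE linked_refl.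
rewrite /rooted_monomial starZ starXn prednK; last by apply/card_gt0P; exists (root G).
rewrite /monomial [RHS](bigD1 (component A (root G))); last exact: component_in.
rewrite mulrC.
apply: (congr1 ( *%R _)); apply: eq_bigl => C.
case AC: (C \in components A) => //=; congr negb.
by apply/idP/eqP => [/(component_id AC)|->].
Qed.

(** * Components of an edge set spread over two pieces *)

(** The two ways of putting together edge sets A and B of two rooted graphs are
    treated at once: [c] tells whether the components of the two roots become
    connected.  The maps i and j may overlap, which covers an identification
    of the roots as well as an edge between them. *)
Section Merge.
Variables (G H K : sgraph) (i : G -> K) (j : H -> K) (r : G) (s : H) (c : bool).
Variables (A : {set {set G}}) (B : {set {set H}}) (D : {set {set K}}).
Hypotheses (inj_i : injective i) (inj_j : injective j).
Hypothesis cover_ij : forall u, (exists x, u = i x) \/ (exists y, u = j y).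
Hypothesis linked_ii : forall x x', linked D (i x) (i x') = linked A x x'.
Hypothesis linked_jj : forall y y', linked D (j y) (j y') = linked B y y'.
Hypothesis linked_ij : forall x y,
  linked D (i x) (j y) = [&& c, linked A r x & linked B s y].

Lemma component_left x :
  ~~ (c && linked A r x) -> component D (i x) = i @: component A x.
Proof.
move=> far; apply/setP=> u; rewrite mem_component.
case: (cover_ij u) => -[v ->]; first by rewrite linked_ii mem_imset // mem_component.
rewrite linked_ij andbA (negPf far) /=; apply/esym/imsetP=> -[x' + e].
rewrite mem_component -linked_ii -e linked_ij => /and3P[c1 rx _].
by move: far; rewrite c1 rx.
Qed.

Lemma component_right y :
  ~~ (c && linked B s y) -> component D (j y) = j @: component B y.
Proof.
move=> far; apply/setP=> u; rewrite mem_component.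
case: (cover_ij u) => -[v ->]; last by rewrite linked_jj mem_imset // mem_component.
rewrite linked_sym linked_ij andbCA (negPf far) andbF; apply/esym/imsetP=> -[y' + e].
rewrite mem_component -linked_jj -e linked_sym linked_ij => /and3P[c1 _ sy].
by move: far; rewrite c1 sy.
Qed.

Lemma component_both : c ->
  component D (i r) = (i @: component A r) :|: (j @: component B s).
Proof.
move=> c1; apply/setP=> u; rewrite mem_component inE.
case: (cover_ij u) => -[v ->].
  rewrite linked_ii mem_imset // mem_component; apply/idP/orP; first by left.
  case=> // /imsetP[y]; rewrite mem_component => sy e.
  by rewrite -linked_ii e linked_ij c1 linked_refl.
rewrite linked_ij c1 linked_refl /= mem_imset // mem_component orbC.
apply/idP/orP; first by left.
case=> // /imsetP[x]; rewrite mem_component -linked_ii => rx e.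
by move: rx; rewrite -e linked_ij => /and3P[].
Qed.

(** Away from the root, the components are the images of those of A that avoid
    r and of those of B, except the one of s when it is absorbed by the root
    component. *)
Lemma prod_components_merge (V : comPzRingType) (w : nat -> V) :
  \prod_(C in components D | i r \notin C) w #|C| =
  \prod_(C in components A | r \notin C) w #|C| *
  \prod_(C in components B | ~~ (c && (s \in C))) w #|C|.
Proof.
pose SA := [set C in components A | r \notin C].
pose SB := [set C in components B | ~~ (c && (s \in C))].
have memA x : component A x \in SA = ~~ linked A r x.
  by rewrite inE component_in mem_component linked_sym.
have memB y : component B y \in SB = ~~ (c && linked B s y).
  by rewrite inE component_in mem_component linked_sym.
have eqS : [set C in components D | i r \notin C] =
           image_sets i SA :|: image_sets j SB.
  apply/setP=> C; rewrite !inE; apply/andP/orP.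
    case=> /componentsP[u ->]; rewrite mem_component.
    case: (cover_ij u) => -[v ->].
      rewrite linked_ii linked_sym => rv; left; apply/imsetP.
      exists (component A v); first by rewrite memA.
      by rewrite component_left // negb_and rv orbT.
    rewrite linked_sym linked_ij linked_refl /= => sv; right; apply/imsetP.
    by exists (component B v); rewrite ?memB // component_right.
  case=> /imsetP[E EA ->].
    have /componentsP[x Ex] : E \in components A by case/setIdP: EA.
    move: EA; rewrite {}Ex memA => rx.
    have far : ~~ (c && linked A r x) by rewrite negb_and rx orbT.
    rewrite -component_left // component_in; split=> //.
    by rewrite mem_component linked_ii linked_sym.
  have /componentsP[y Ey] : E \in components B by case/setIdP: EA.
  move: EA; rewrite {}Ey memB => far.
  rewrite -component_right // component_in; split=> //.
  by rewrite mem_component linked_sym linked_ij linked_refl.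
have dis : [disjoint image_sets i SA & image_sets j SB].
  rewrite -setI_eq0; apply/eqP/setP=> C; rewrite !inE.
  apply/negP=> /andP[/imsetP[E EA eE] /imsetP[F FB eF]].
  have /componentsP[x Ex] : E \in components A by case/setIdP: EA.
  have /componentsP[y Ey] : F \in components B by case/setIdP: FB.
  have : i x \in C by rewrite eE Ex imset_f // mem_component linked_refl.
  rewrite eF => /imsetP[y' y'F e].
  have : linked D (i x) (j y') by rewrite e linked_refl.
  rewrite linked_ij => /and3P[_ rx _].
  by move: EA; rewrite Ex memA rx.
have toset (T : finType) (X : {set {set T}}) (P : pred {set T}) :
    \prod_(C in X | P C) w #|C| = \prod_(C in [set C in X | P C]) w #|C|.
  by apply: eq_bigl => C; rewrite inE.
have image (T : finType) (f : T -> K) (X : {set {set T}}) : injective f ->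
    \prod_(C in image_sets f X) w #|C| = \prod_(C in X) w #|C|.
  move=> injf; rewrite big_imset /=; last by move=> ? ? _ _; apply: imset_inj.
  by apply: eq_bigr => C _; rewrite card_imset.
rewrite !toset eqS -(image _ i SA) // -(image _ j SB) // -bigU //=.
by apply: eq_bigl => C; rewrite !inE.
Qed.

End Merge.

Lemma scaler_polyC (R : comNzRingType) (a b : R) (f : {poly R}) :
  (a * b) *: f = (a *: f) * b%:P.
Proof. by rewrite mulrC -scalerA -mul_polyC mulrC. Qed.

Lemma image_set2 (T T' : finType) (f : T -> T') (A : {set {set T}}) u v :
  injective f -> [set u; v] \in image_sets f A ->
  exists a b, [/\ u = f a, v = f b & [set a; b] \in A].
Proof.
move=> injf /imsetP[E EA e].
have /imsetP[a _ ea] : u \in f @: E by rewrite -e set21.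
have /imsetP[b _ eb] : v \in f @: E by rewrite -e set22.
exists a, b; split=> //; suff -> : [set a; b] = E by [].
by apply: (imset_inj injf); rewrite -e ea eb imsetU1 imset_set1.
Qed.

(** The retractions p and q collapse the opposite piece onto its root, so that
    two vertices are connected in the union exactly when both their projections
    are. *)
Section Connected.
Variables (G H K : sgraph) (i : G -> K) (j : H -> K) (r : G) (s : H).
Variables (A : {set {set G}}) (B : {set {set H}}) (D : {set {set K}}).
Variables (p : K -> G) (q : K -> H).
Hypotheses (pi : cancel i p) (pj : forall y, p (j y) = r).
Hypotheses (qi : forall x, q (i x) = s) (qj : cancel j q).
Hypotheses (subA : image_sets i A \subset D) (subB : image_sets j B \subset D).
Hypothesis subD : forall e, e \in D ->
  [\/ e \in image_sets i A, e \in image_sets j B | e = [set i r; j s]].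
Hypothesis bridge : linked D (i r) (j s).

Lemma linked_proj u v :
  linked D u v -> linked A (p u) (p v) && linked B (q u) (q v).
Proof.
apply: (linked_min (S := fun u v => linked A (p u) (p v) && linked B (q u) (q v))).
- by move=> x; rewrite !linked_refl.
- move=> y x z /andP[a b] /andP[a' b'].
  by rewrite (linked_trans a a') (linked_trans b b').
move=> x y /subD[/(image_set2 (can_inj pi))|/(image_set2 (can_inj qj))|/set2_eq].
- by case=> a [b [-> -> ab]]; rewrite !pi !qi linked_refl andbT linked1.
- by case=> a [b [-> -> ab]]; rewrite !qj !pj linked_refl linked1.
by case=> -[-> ->]; rewrite ?pi ?pj ?qi ?qj !linked_refl.
Qed.

Lemma linked_glue_left x x' : linked D (i x) (i x') = linked A x x'.
Proof.
by apply/idP/idP => [/linked_proj/andP[]|]; [rewrite !pi | apply: linked_image].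
Qed.

Lemma linked_glue_right y y' : linked D (j y) (j y') = linked B y y'.
Proof.
by apply/idP/idP => [/linked_proj/andP[]|]; [rewrite !qj | apply: linked_image].
Qed.

Lemma linked_glue_across x y :
  linked D (i x) (j y) = [&& true, linked A r x & linked B s y].
Proof.
apply/idP/andP => [/linked_proj|[_ /andP[rx sy]]].
  by rewrite pi pj qi qj linked_sym.
apply: (@linked_trans _ _ (i r)); first by rewrite linked_glue_left linked_sym.
by apply: (linked_trans bridge); rewrite linked_glue_right.
Qed.

Hypothesis cover_ij : forall u, (exists x, u = i x) \/ (exists y, u = j y).

Lemma prod_components_glue :
  \prod_(C in components D | i r \notin C) x_ #|C| =
  (\prod_(C in components A | r \notin C) x_ #|C|) *
  (\prod_(C in components B | s \notin C) x_ #|C|).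
Proof.
exact: (prod_components_merge (can_inj pi) (can_inj qj) cover_ij linked_glue_left
  linked_glue_right linked_glue_across x_).
Qed.

Lemma component_glue :
  component D (i r) = i @: component A r :|: j @: component B s.
Proof.
exact: (component_both (can_inj pi) (can_inj qj) cover_ij linked_glue_left
  linked_glue_across isT).
Qed.

(** The two root components overlap in the common root if the roots are
    identified, and nowhere if they are joined by an edge. *)
Lemma card_component_glue :
  (#|component D (i r)| + (i r == j s) =
   #|component A r| + #|component B s|)%N.
Proof.
rewrite component_glue cardsU !card_imset; try exact: can_inj pi; try exact: can_inj qj.
set I := _ :&: _; have -> : I = if i r == j s then [set i r] else set0.
  apply/setP=> u; apply/setIP/idP.
    case=> /imsetP[x _ ->] /imsetP[y _ e].
    have xr : x = r by rewrite -(pi x) e pj.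
    have ys : y = s by rewrite -(qj y) -e qi.
    by rewrite xr ys in e *; rewrite e eqxx set11.
  case: eqP => [e|_]; rewrite inE // => /eqP ->.
  by split; [|rewrite e]; rewrite imset_f // mem_component linked_refl.
have := leq_imset_card i (component A r).
case: eqP => _; rewrite ?cards1 ?cards0 ?subn0 ?addn0 // subnK //.
by rewrite addn_gt0; apply/orP; left; apply/card_gt0P; exists r;
  rewrite mem_component linked_refl.
Qed.

Lemma rooted_monomial_identify :
  i r = j s -> rooted_monomial D (i r) = rooted_monomial A r * rooted_monomial B s.
Proof.
move=> e; rewrite /rooted_monomial prod_components_glue.
rewrite -scalerAl -scalerAr scalerA -exprD.
have := card_component_glue; rewrite e eqxx -e.
have : (0 < #|component A r|)%N.
  by apply/card_gt0P; exists r; rewrite mem_component linked_refl.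
have : (0 < #|component B s|)%N.
  by apply/card_gt0P; exists s; rewrite mem_component linked_refl.
case: #|component A r| => // a; case: #|component B s| => // b _ _.
by rewrite addn1 addSn addnS => -[->].
Qed.

Lemma rooted_monomial_bridge :
  i r != j s ->
  rooted_monomial D (i r) = rooted_monomial A r * ('X * rooted_monomial B s).
Proof.
move=> ne; rewrite /rooted_monomial prod_components_glue.
rewrite -!scalerAr -scalerAl scalerA -exprS -exprD [in RHS]mulrC.
have := card_component_glue; rewrite (negPf ne) addn0 => ->.
have : (0 < #|component A r|)%N.
  by apply/card_gt0P; exists r; rewrite mem_component linked_refl.
have : (0 < #|component B s|)%N.
  by apply/card_gt0P; exists s; rewrite mem_component linked_refl.
by case: #|component A r| => // a; case: #|component B s| => // b _ _; rewrite addnS.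
Qed.

End Connected.

(** The edge sets of the joining by an edge that omit this edge. *)
Section Disconnected.
Variables (G H : rgraph) (A : {set {set G}}) (B : {set {set H}}).
Let K := cdot G H.
Let i : G -> K := inl.
Let j : H -> K := inr.
Let D := image_sets i A :|: image_sets j B.

Let inj_i : injective i. Proof. by move=> x y []. Qed.
Let inj_j : injective j. Proof. by move=> x y []. Qed.

Lemma linked_sum (u v : K) :
  linked D u v = match u, v with
                 | inl x, inl y => linked A x y
                 | inr x, inr y => linked B x y
                 | _, _ => false
                 end.
Proof.
pose S (u v : K) := match u, v with
                    | inl x, inl y => linked A x y
                    | inr x, inr y => linked B x y
                    | _, _ => false
                    end.
apply/idP/idP.
  apply: (linked_min (S := S)).
  - by case=> x /=; rewrite linked_refl.
  - by case=> y [] x [] z //=; apply: linked_trans.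
  by move=> x y /setUP[/(image_set2 inj_i)|/(image_set2 inj_j)] [a [b [-> -> ab]]];
    apply: linked1.
case: u v => x [] y //= xy.
  by apply: (linked_image (f := i) (A := A)); rewrite ?subsetUl.
by apply: (linked_image (f := j) (A := B)); rewrite ?subsetUr.
Qed.

Lemma rooted_monomial_sum :
  rooted_monomial D (root K) = rooted_monomial A (root G) * (monomial B)%:P.
Proof.
have cover_ij (u : K) : (exists x, u = i x) \/ (exists y, u = j y).
  by case: u => x; [left | right]; exists x.
have lij x y : linked D (i x) (j y) =
    [&& false, linked A (root G) x & linked B (root H) y] by rewrite linked_sum.
have lii x x' : linked D (i x) (i x') = linked A x x' by rewrite linked_sum.
have ljj y y' : linked D (j y) (j y') = linked B y y' by rewrite linked_sum.
rewrite /rooted_monomial (prod_components_merge inj_i inj_j cover_ij lii ljj lij x_).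
rewrite (component_left inj_i cover_ij lii lij) // card_imset //.
rewrite scaler_polyC; congr (_ *: _ * _%:P).
by apply: eq_bigl => C; rewrite andbT.
Qed.

End Disconnected.

(** * The rooted U-polynomial of the joinings *)

Lemma sum_edge_subsets (G K : sgraph) (V : nmodType) (f : G -> K)
    (E : {set {set G}}) (F : {set {set K}} -> V) :
  injective f ->
  \sum_(A : {set {set K}} | A \subset image_sets f E) F A =
  \sum_(A : {set {set G}} | A \subset E) F (image_sets f A).
Proof. by move=> injf; apply/sum_subsets_imset/imset_inj. Qed.

(** A common edge would have both ends at the root. *)
Lemma disjoint_edges (G H : rgraph) (K : sgraph) (i : G -> K) (j : H -> K)
    (p : K -> G) :
  cancel i p -> (forall y, p (j y) = root G) ->
  [disjoint image_sets i (edges G) & image_sets j (edges H)].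
Proof.
move=> pi pj; rewrite -setI_eq0; apply/eqP/setP=> e; rewrite !inE.
apply/negP=> /andP[/imsetP[E /edgesP[x [x' [-> xx']]] ->] /imsetP[F _ eF]].
have onroot z : z \in [set x; x'] -> z = root G.
  by move/(imset_f i); rewrite eF => /imsetP[y _ e']; rewrite -(pi z) e' pj.
by move: xx'; rewrite (onroot x) ?set21 // (onroot x') ?set22 // adj_irr.
Qed.

Lemma edge_image (G K : sgraph) (f : G -> K) x y :
  adj x y -> [set f x; f y] \in image_sets f (edges G).
Proof.
move=> xy; apply/imsetP; exists [set x; y]; last by rewrite imsetU1 imset_set1.
by apply/edgesP; exists x, y.
Qed.

Lemma edge_imageP (G K : sgraph) (f : G -> K) e :
  e \in image_sets f (edges G) -> exists x y, e = [set f x; f y] /\ adj x y.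
Proof.
by case/imsetP=> F /edgesP[x [y [-> xy]]] ->; exists x, y; rewrite imsetU1 imset_set1.
Qed.

(** Edge sets of K are pairs of edge sets of G and H.  The statement allows any
    graph K obtained by gluing G and H at their roots: besides [odot], gluing
    with a single vertex makes it yield isomorphism invariance. *)
Lemma rooted_U_glue (G H K : rgraph) (i : G -> K) (j : H -> K)
    (p : K -> G) (q : K -> H) :
  cancel i p -> (forall y, p (j y) = root G) ->
  (forall x, q (i x) = root H) -> cancel j q ->
  (forall u, (exists x, u = i x) \/ (exists y, u = j y)) ->
  i (root G) = root K -> j (root H) = root K ->
  (forall x x', adj (i x) (i x') = adj x x') ->
  (forall y y', adj (j y) (j y') = adj y y') ->
  (forall x y, adj (i x) (j y) -> x = root G \/ y = root H) ->
  rooted_U K = rooted_U G * rooted_U H.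
Proof.
move=> pi pj qi qj cover ir js adji adjj adjij.
have edgesK : edges K = image_sets i (edges G) :|: image_sets j (edges H).
  have edge_ij x y : adj (i x) (j y) ->
      [set i x; j y] \in image_sets i (edges G) :|: image_sets j (edges H).
    move=> xy; rewrite inE; apply/orP; case: (adjij _ _ xy) => e.
      by right; rewrite e ir -js edge_image // -adjj js -ir -e.
    by left; rewrite e js -ir edge_image // -adji ir -js -e.
  apply/setP=> e; apply/edgesP/idP.
    case=> u [v [-> uv]].
    case: (cover u) (cover v) uv => [[x ->]|[y ->]] [[x' ->]|[y' ->]] uv.
    - by rewrite inE edge_image // -adji.
    - exact: edge_ij.
    - by rewrite [[set j y; _]]setUC edge_ij // adj_sym.
    - by rewrite inE orbC edge_image // -adjj.
  by case/setUP=> /edge_imageP[x [y [-> xy]]];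
    [exists (i x), (i y) | exists (j x), (j y)]; rewrite ?adji ?adjj.
rewrite {1}/rooted_U edgesK sum_subsetsU; last exact: disjoint_edges pi pj.
rewrite sum_edge_subsets; last exact: can_inj pi.
rewrite big_distrlr /=; apply: eq_bigr => A _.
rewrite sum_edge_subsets; last exact: can_inj qj.
apply: eq_bigr => B _; rewrite -ir.
apply: (rooted_monomial_identify pi pj qi qj) => //; rewrite ?subsetUl ?subsetUr //.
- by move=> e /setUP[]; [constructor 1 | constructor 2].
- by rewrite ir -js linked_refl.
- by rewrite ir js.
Qed.

Lemma rooted_U_odot (G H : rgraph) : rooted_U (odot G H) = rooted_U G * rooted_U H.
Proof.
(* In [odot] the root of H is represented by the root of G. *)
pose i (x : G) : odot G H := inl x.
pose j (y : H) : odot G H :=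
  if insub y is Some y' then inr y' else inl (root G).
pose p (u : odot G H) : G := if u is inl x then x else root G.
pose q (u : odot G H) : H := if u is inr y then val y else root H.
have jP y : (y = root H /\ j y = inl (root G)) \/
            exists y', val y' = y /\ j y = inr y'.
  rewrite /j; case: insubP => [y' _ vy|/negPn/eqP->]; last by left.
  by right; exists y'.
apply: (@rooted_U_glue _ _ _ i j p q) => //.
- by move=> y; case: (jP y) => [[_ ->]|[y' [_ ->]]].
- by move=> y; case: (jP y) => [[-> ->]|[y' [<- ->]]].
- case=> [x|y]; first by left; exists x.
  by right; exists (val y); rewrite /j valK.
- by rewrite /j insubF // eqxx.
- move=> y z; case: (jP y) (jP z) => [[-> ->]|[y' [<- ->]]] [[-> ->]|[z' [<- ->]]] //=.
  + by rewrite !adj_irr.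
  + by rewrite /adj /= eqxx.
  + by rewrite [RHS]adj_sym /adj /= eqxx.
- move=> x y; case: (jP y) => [[-> _]|[y' [_ ->]]]; first by right.
  by case/andP=> /eqP; left.
Qed.

Definition K1 : rgraph := @RGraph (path_graph 1) ord0.

Lemma K1_unit (x : K1) : x = root K1.
Proof. exact: ord1. Qed.

Lemma edges_K1 : edges K1 = set0.
Proof.
apply/setP=> e; rewrite inE; apply/negP=> /edgesP[x [y [_]]].
by rewrite (K1_unit x) (K1_unit y) adj_irr.
Qed.

Lemma rooted_U_K1 : rooted_U K1 = 1.
Proof.
rewrite /rooted_U edges_K1 (big_pred1 set0) => [|A]; last by rewrite subset0.
have full : component set0 (root K1) = setT.
  by apply/setP=> y; rewrite mem_component inE (K1_unit y) linked_refl.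
rewrite /rooted_monomial full big1 ?scale1r.
  by rewrite cardsT card_ord.
move=> C /andP[/componentsP[x ->]] /negP[].
by rewrite mem_component (K1_unit x) linked_refl.
Qed.

(** An isomorphic copy is a gluing with [K1]. *)
Lemma rooted_U_iso (G H : rgraph) (f : G -> H) :
  bijective f -> (forall x y, adj (f x) (f y) = adj x y) -> f (root G) = root H ->
  rooted_U G = rooted_U H.
Proof.
case=> g gf fg adjf fr; rewrite -[rooted_U G]mulr1 -rooted_U_K1; apply/esym.
apply: (@rooted_U_glue _ _ _ f (fun _ : K1 => root H) g (fun=> root K1)) => //.
- by move=> _; rewrite -fr gf.
- by move=> x; rewrite (K1_unit x).
- by move=> u; left; exists (g u).
- by move=> x y; rewrite (K1_unit x) (K1_unit y) !adj_irr.
- by move=> x y; right; apply: K1_unit.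
Qed.

Lemma U_iso (G H : rgraph) : isomorphic G H -> U G = U H.
Proof.
case=> f [bijf adjf]; pose H' := @RGraph H (f (root G)).
by rewrite -(star_rooted_U G) -(star_rooted_U H') (rooted_U_iso (H := H') bijf adjf).
Qed.

(** The first summand of the second factor collects the edge sets that contain
    the new edge, through which the root component of H joins that of G; the
    other one collects those that omit it. *)
Lemma rooted_U_cdot (G H : rgraph) :
  rooted_U (cdot G H) = rooted_U G * ('X * rooted_U H + (U H)%:P).
Proof.
pose i (x : G) : cdot G H := inl x.
pose j (y : H) : cdot G H := inr y.
pose p (u : cdot G H) : G := if u is inl x then x else root G.
pose q (u : cdot G H) : H := if u is inr y then y else root H.
have pi : cancel i p by [].
have qj : cancel j q by [].
(* Edge sets are indexed by an edge set of G, one of H, and the presence of the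
   new edge. *)
pose bridge : {set cdot G H} := [set i (root G); j (root H)].
pose E := image_sets i (edges G) :|: image_sets j (edges H).
have edgesK : edges (cdot G H) = E :|: [set bridge].
  apply/setP=> e; apply/edgesP/idP.
    case=> -[x|x] [] [y|y] [-> xy]; rewrite !inE.
    - by rewrite (edge_image i xy).
    - by case/andP: xy => /eqP -> /eqP ->; rewrite eqxx !orbT.
    - by case/andP: xy => /eqP -> /eqP ->; rewrite [[set inr _; _]]setUC eqxx !orbT.
    - by rewrite (edge_image j xy) orbT.
  case/setUP=> [/setUP[]/edge_imageP[x [y [-> xy]]]|/set1P ->].
  - by exists (i x), (i y).
  - by exists (j x), (j y).
  by exists (i (root G)), (j (root H)); split=> //; apply/andP.
have disE : [disjoint E & [set bridge]].
  rewrite disjoint_sym disjoints1 !inE negb_or; apply/andP; split.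
    apply/imsetP=> -[F _ /setP/(_ (j (root H)))].
    by rewrite set22 => /esym /imsetP[].
  apply/imsetP=> -[F _ /setP/(_ (i (root G)))].
  by rewrite set21 => /esym /imsetP[].
rewrite {1}/rooted_U edgesK sum_subsetsU //.
rewrite sum_subsetsU; last exact: (disjoint_edges pi).
rewrite sum_edge_subsets; last exact: can_inj pi.
rewrite /rooted_U mulr_suml; apply: eq_bigr => A _.
rewrite sum_edge_subsets; last exact: can_inj qj.
rewrite mulr_sumr U_monomial rmorph_sum -big_split mulr_sumr /=.
apply: eq_bigr => B _; rewrite sum_subsets1 setU0 mulrDr addrC.
rewrite -rooted_monomial_sum; congr (_ + _).
apply: (@rooted_monomial_bridge _ _ _ i j _ _ _ _ _ p q) => //.
- by rewrite -setUA subsetUl.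
- by rewrite setUAC subsetUr.
- by move=> e /setUP[/setUP[]|/set1P]; [constructor 1|constructor 2|constructor 3].
- by apply: linked1; rewrite !inE eqxx orbT.
- by case=> x; [left | right]; exists x.
Qed.

Lemma U_K1 : U K1 = x_ 1.
Proof. by rewrite -star_rooted_U rooted_U_K1 -(starXn 0). Qed.

(** * The paths on three vertices *)

(** A_0 and B_0 are joinings by an edge of paths on one and two vertices, so
    their rooted polynomials follow from the rule for [cdot]. *)
Definition K2 : rgraph := cdot K1 K1.

Lemma rooted_U_K2 : rooted_U K2 = 'X + (x_ 1)%:P.
Proof. by rewrite rooted_U_cdot rooted_U_K1 U_K1 mul1r mulr1. Qed.

Lemma U_K2 : U K2 = x_ 2 + x_ 1 * x_ 1.
Proof. by rewrite -star_rooted_U rooted_U_K2 starD starX star_polyC. Qed.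

Lemma rooted_U_A0 : rooted_U A0 = ('X + (x_ 1)%:P) * ('X + (x_ 1)%:P).
Proof.
pose f (u : cdot K2 K1) : 'I_3 :=
  match u with
  | inl (inl _) => @Ordinal 3 1 isT
  | inl (inr _) => @Ordinal 3 0 isT
  | inr _ => @Ordinal 3 2 isT
  end.
have <- : rooted_U (cdot K2 K1) = rooted_U A0.
  apply: (rooted_U_iso (f := f : _ -> A0)) => //.
    apply: inj_card_bij; last by rewrite !card_sum !card_ord.
    case=> [[x|x]|x] [[y|y]|y] //= _; by rewrite (K1_unit x) (K1_unit y).
  by case=> [[x|x]|x] [[y|y]|y] //=; rewrite (K1_unit x) (K1_unit y).
by rewrite rooted_U_cdot rooted_U_K2 rooted_U_K1 U_K1 mulr1.
Qed.

Lemma rooted_U_B0 : rooted_U B0 = 'X * ('X + (x_ 1)%:P) + (x_ 2 + x_ 1 * x_ 1)%:P.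
Proof.
pose f (u : cdot K1 K2) : 'I_3 :=
  match u with
  | inl _ => @Ordinal 3 0 isT
  | inr (inl _) => @Ordinal 3 1 isT
  | inr (inr _) => @Ordinal 3 2 isT
  end.
have <- : rooted_U (cdot K1 K2) = rooted_U B0.
  apply: (rooted_U_iso (f := f : _ -> B0)) => //.
    apply: inj_card_bij; last by rewrite !card_sum !card_ord.
    case=> [x|[x|x]] [y|[y|y]] //= _; by rewrite (K1_unit x) (K1_unit y).
  by case=> [x|[x|x]] [y|[y|y]] //=; rewrite (K1_unit x) (K1_unit y).
by rewrite rooted_U_cdot rooted_U_K2 rooted_U_K1 U_K2 mul1r.
Qed.

(** * Ring identities *)

(** They are applied to U-polynomials and to polynomials over them, whose
    operations are too intricate to be unfolded in a calculation. *)

Section RingIdentities.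
Variable R : comNzRingType.

Lemma center_minus_leaf (x a b : R) :
  (x + a) * (x + a) = x * (x + a) + (b + a * a) + (a * x - b).
Proof. ring. Qed.

Lemma exchange_step (x a b u p d : R) :
  a = b + p * d ->
  a * (x * b + u) = b * (x * a + u) + p * u * d.
Proof. move=> ->; ring. Qed.

Lemma exchange_products (a a' b b' : R) :
  a' * b * (b' * a) = a * a' * (b * b').
Proof. ring. Qed.

Lemma exchange_forms (c d bb eb eb' ee : R) :
  (bb + c * eb' + d * eb + c * d * ee) * bb - (bb + d * eb) * (bb + c * eb') =
  c * d * (ee * bb - eb * eb').
Proof. ring. Qed.

Lemma addr_reorder (x y z t : R) : x + y + (z + t) = x + z + y + t.
Proof. ring. Qed.

Lemma cdot_minus_top (g h x y p : R) :
  g * (x * h + p) - x * (y * y) = (g - y) * (x * y) + ((h - y) * (x * g) + p * g).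
Proof. ring. Qed.

Lemma center_minus_top (x a : R) :
  (x + a) * (x + a) - x ^+ 2 = a * (x + (x + a)).
Proof. ring. Qed.

Lemma leaf_minus_top (x a b : R) : x * (x + a) + b - x ^+ 2 = a * x + b.
Proof. ring. Qed.

Lemma subr_mulr0 (a b c : R) : c = 0 -> a - b * c = a.
Proof. by move=> ->; rewrite mulr0 subr0. Qed.

End RingIdentities.

Section MorphismIdentities.
Variables (R S : pzRingType) (f : {rmorphism R -> S}).

Lemma rmorph_prodB (a b c d : R) (x : S) :
  f a = 0 -> f c = x -> f (a * b - c * d) = - (x * f d).
Proof. by move=> a0 cx; rewrite rmorphB !rmorphM a0 cx mul0r sub0r. Qed.

Lemma rmorph_exchange (p q d b u v : R) (p' q' u' v' : S) :
  f p = p' -> f q = q' -> f d = 0 -> f u = - u' -> f v = - v' ->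
  - f (p * q * (d * b - u * v)) = p' * q' * (u' * v').
Proof.
move=> <- <- d0 fu fv; rewrite !rmorphM rmorphB !rmorphM d0 fu fv.
by rewrite mul0r sub0r mulrNN mulrN opprK.
Qed.

End MorphismIdentities.

(** * The difference of the two U-polynomials *)

Definition delta : {poly upoly} := x_ 1 *: 'X - (x_ 2)%:P.

Lemma rooted_U_A0B0 : rooted_U A0 = rooted_U B0 + delta.
Proof.
rewrite rooted_U_A0 rooted_U_B0 /delta -mul_polyC polyCD polyCM.
exact: center_minus_leaf.
Qed.

Lemma U_cdot (G H : rgraph) :
  U (cdot G H) = star ('X * (rooted_U G * rooted_U H)) + U H * U G.
Proof.
rewrite -star_rooted_U rooted_U_cdot mulrDr starD.
rewrite [rooted_U G * _%:P]mulrC mul_polyC starZ star_rooted_U.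
by rewrite [rooted_U G * ('X * _)]mulrCA.
Qed.

(** For k = 0 both trees are the same path; afterwards the formula [U_cdot] is
    symmetric. *)
Lemma U_B_eq_A k : U (B_ k) = U (A_ k).
Proof.
case: k => [|k] //=; rewrite !U_cdot.
by rewrite [rooted_U (B_ k) * _]mulrC [U (A_ k) * _]mulrC.
Qed.

(** In the rule for [cdot] the products that carry X are the same for
    A_k cdot B_k and B_k cdot A_k; so only the parts without the new edge
    differ, by the previous difference times U (A_ k). *)
Lemma rooted_U_A_sub_B k :
  rooted_U (A_ k) = rooted_U (B_ k) + (\prod_(i < k) U (A_ i)) *: delta.
Proof.
elim: k => [|k IH]; first by rewrite big_ord0 scale1r rooted_U_A0B0.
rewrite [A_ _]/= [B_ _]/= !rooted_U_cdot big_ord_recr /= U_B_eq_A -mul_polyC polyCM.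
by apply: exchange_step; rewrite mul_polyC.
Qed.

(** A polarization identity for the symmetric bilinear form star (f g): moving
    the multiples of e between the factors only leaves a 2 by 2 Gram
    determinant. *)
Lemma star_exchange (c d : upoly) (b b' e : {poly upoly}) :
  star ((b + c *: e) * (b' + d *: e)) * star (b * b') -
  star ((b' + d *: e) * b) * star (b' * (b + c *: e)) =
  c * d * (star (e * e) * star (b * b') - star (e * b) * star (e * b')).
Proof.
have -> : star ((b + c *: e) * (b' + d *: e)) =
  star (b * b') + c * star (e * b') + d * star (e * b) + c * d * star (e * e).
  rewrite mulrDl !mulrDr -!scalerAl -!scalerAr scalerA !starD !starZ.
  by rewrite [b * e]mulrC; apply: addr_reorder.
have -> : star ((b' + d *: e) * b) = star (b * b') + d * star (e * b).
  by rewrite mulrDl -scalerAl starD starZ [b' * b]mulrC.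
have -> : star (b' * (b + c *: e)) = star (b * b') + c * star (e * b').
  by rewrite mulrDr -scalerAr starD starZ [b' * b]mulrC [b' * e]mulrC.
exact: exchange_forms.
Qed.

(** Edge sets containing the edge between the two halves contribute star of X
    times the product of the same four rooted polynomials on both sides; the
    others contribute the two products compared by [star_exchange]. *)
Lemma U_YZ k l :
  U (Y k l) - U (Z k l) =
  (\prod_(i < k) U (A_ i)) * (\prod_(i < l) U (A_ i)) *
  (star (delta * delta) * star (rooted_U (B_ k) * rooted_U (B_ l)) -
   star (delta * rooted_U (B_ k)) * star (delta * rooted_U (B_ l))).
Proof.
rewrite -star_exchange -!rooted_U_A_sub_B /Y /Z !U_cdot -!star_rooted_U !rooted_U_odot.
have -> : rooted_U (A_ l) * rooted_U (B_ k) * (rooted_U (B_ l) * rooted_U (A_ k)) =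
          rooted_U (A_ k) * rooted_U (A_ l) * (rooted_U (B_ k) * rooted_U (B_ l)).
  exact: exchange_products.
rewrite opprD addrACA subrr add0r.
by rewrite [star (rooted_U (A_ k) * _) * _]mulrC [star (rooted_U (A_ l) * _) * _]mulrC.
Qed.

(** * Lower bound for the degrees *)

Definition order_ge (d : nat) (f : upoly) : Prop :=
  forall m, f@_m != 0 -> (d <= mdeg m)%N.

Lemma truncateE d (f : upoly) m :
  (truncate d f)@_m = if (mdeg m <= d)%N then f@_m else 0.
Proof.
rewrite /truncate raddf_sum /=.
transitivity (\sum_(m' <- msupp f | (mdeg m' <= d)%N) f@_m' *+ (m' == m)).
  by apply: eq_bigr => m' _; rewrite mcoeffU.
case: (msuppP f m) => [fm|fm]; last first.
  rewrite if_same big_seq_cond big1 // => m' /andP[fm' _].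
  by rewrite (negPf (_ : m' != m)) //; apply: contraNneq fm => <-.
rewrite big_mkcond (bigD1_seq m) ?fset_uniq //= eqxx mulr1n big1 ?addr0 //.
by move=> m' /negPf ->; rewrite mulr0n if_same.
Qed.

Lemma truncate_eq d (f g : upoly) :
  truncate d f = truncate d g <-> order_ge d.+1 (f - g).
Proof.
split=> [e m|lowfg].
  apply: contraR; rewrite -leqNgt => led; rewrite mcoeffB subr_eq0.
  have [ef eg] := (truncateE d f m, truncateE d g m).
  rewrite led in ef eg; apply/eqP; exact: etrans (esym ef) (etrans (congr1 _ e) eg).
apply/malgP=> m; have [ef eg] := (truncateE d f m, truncateE d g m).
apply: etrans ef (etrans _ (esym eg)); case: ifP => // led; apply/eqP.
by rewrite -subr_eq0 -mcoeffB; apply: contraT => /lowfg; rewrite ltnNge led.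
Qed.

Lemma order_ge0 d : order_ge d 0.
Proof. by move=> m; rewrite mcoeff0 eqxx. Qed.

Lemma order_ge_any f : order_ge 0 f. Proof. by []. Qed.

Lemma order_geD d f g : order_ge d f -> order_ge d g -> order_ge d (f + g).
Proof.
move=> lf lg m; rewrite mcoeffD; case: (eqVneq f@_m 0) => [->|/lf //].
by rewrite add0r => /lg.
Qed.

Lemma order_geN d f : order_ge d f -> order_ge d (- f).
Proof. by move=> lf m; rewrite mcoeffN oppr_eq0 => /lf. Qed.

Lemma order_geB d f g : order_ge d f -> order_ge d g -> order_ge d (f - g).
Proof. by move=> lf lg; apply: order_geD lf (order_geN lg). Qed.

Lemma order_geM a b f g : order_ge a f -> order_ge b g -> order_ge (a + b) (f * g).
Proof.
move=> lf lg m; rewrite mcoeff_neq0 => /msuppM_le.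
move=> [m1 [m2 [fm1 gm2 ->]]].
by rewrite mdegM leq_add // ?lf ?lg // mcoeff_neq0.
Qed.

Lemma order_ge_sum d (I : Type) (s : seq I) (P : pred I) (F : I -> upoly) :
  (forall i, P i -> order_ge d (F i)) -> order_ge d (\sum_(i <- s | P i) F i).
Proof.
move=> lF; apply: (big_ind (order_ge d)) => //.
  exact: order_ge0.
exact: order_geD.
Qed.

Lemma order_ge_x n : order_ge 1 (x_ n).
Proof.
move=> m; rewrite /x_ mcoeffU1; case: (ucm n =P m) => [<- _|_]; last by rewrite eqxx.
by rewrite mdegU.
Qed.

Lemma order_ge_prod n (F : nat -> upoly) :
  (forall i, order_ge 1 (F i)) -> order_ge n (\prod_(i < n) F i).
Proof.
move=> lF; elim: n => [|n IH]; first exact: order_ge_any.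
by rewrite big_ord_recr -[X in order_ge X]addn1; apply: order_geM.
Qed.

Lemma order_ge_star d (f : {poly upoly}) :
  (forall i, order_ge d f`_i) -> order_ge d.+1 (star f).
Proof.
move=> lf; rewrite /star -[d.+1]addn1; apply: order_ge_sum => i _.
by apply: order_geM; [apply: lf | apply: order_ge_x].
Qed.

Lemma order_ge_star1 f : order_ge 1 (star f).
Proof. by apply: order_ge_star => i; apply: order_ge_any. Qed.

(** * Setting x_1 to zero *)

(** The monomial map of the specialization x_1 = 0 and x_i = t for i <> 1, which
    annihilates all but one of the monomials of lowest degree in
    U (Y k l) - U (Z k l). *)
Definition specialize_monom (m : {cmonom nat}) : {poly int} :=
  if m 1%N == 0%N then 'X^(mdeg m) else 0.

Lemma specialize_monom_mmorphism : mmorphism specialize_monom.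
Proof.
split=> [m m'|]; last by rewrite /specialize_monom cm1 mdeg1.
rewrite /specialize_monom cmM mdegM addn_eq0.
by case: eqP => _; case: eqP => _; rewrite ?exprD ?mul0r ?mulr0.
Qed.

HB.instance Definition _ :=
  isMultiplicative.Build {cmonom nat} {poly int} specialize_monom
    specialize_monom_mmorphism.

Definition specialize : {rmorphism upoly -> {poly int}} := mmap intr specialize_monom.

Lemma specialize_x n : specialize (x_ n) = if n == 1%N then 0 else 'X.
Proof.
rewrite /= mmapU mul1r /specialize_monom cmU mdegU.
by case: (n == 1%N).
Qed.

Lemma specialize_order_ge d f : order_ge d f -> exists w, specialize f = 'X^d * w.
Proof.
move=> lf; rewrite /= mmapE big_seq.
apply: (big_ind (fun g : {poly int} => exists w, g = 'X^d * w)).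
- by exists 0; rewrite mulr0.
- by move=> _ _ [v ->] [w ->]; exists (v + w); rewrite mulrDr.
move=> m; rewrite -mcoeff_neq0 => /lf le_d.
exists ((f@_m)%:~R * (if m 1%N == 0%N then 'X^(mdeg m - d) else 0)).
rewrite mulrCA /specialize_monom; case: ifP; rewrite ?mulr0 // => _.
by rewrite -exprD subnKC.
Qed.

Definition monic_order (n : nat) (g : {poly int}) : Prop :=
  exists2 w, g = 'X^n * w & w.[0] = 1.

Lemma monic_orderM a b f g :
  monic_order a f -> monic_order b g -> monic_order (a + b) (f * g).
Proof.
move=> [v -> v1] [w -> w1]; exists (v * w); first by rewrite mulrACA exprD.
by rewrite hornerM v1 w1 mulr1.
Qed.

Lemma monic_orderX : monic_order 1 'X.
Proof. by exists 1; rewrite ?mulr1 ?hornerC. Qed.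

Lemma monic_order_prod n (F : nat -> {poly int}) :
  (forall i, monic_order 1 (F i)) -> monic_order n (\prod_(i < n) F i).
Proof.
move=> oF; elim: n => [|n IH].
  by rewrite big_ord0; exists 1; rewrite ?mulr1 ?hornerC.
by rewrite big_ord_recr -[X in monic_order X]addn1; apply: monic_orderM.
Qed.

Lemma monic_order_exact n (g w : {poly int}) :
  monic_order n g -> g = 'X^(n.+1) * w -> False.
Proof.
move=> [v -> v1]; rewrite exprSr -mulrA => /mulfI.
move=> /(_ (monic_neq0 (monicXn _ _))) e.
by move: v1; rewrite e hornerM hornerX mul0r.
Qed.

Definition order1_coefs (f : {poly upoly}) : Prop := forall i, order_ge 1 f`_i.

Lemma order1_coefsD f g : order1_coefs f -> order1_coefs g -> order1_coefs (f + g).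
Proof. by move=> lf lg i; rewrite coefD; apply: order_geD. Qed.

Lemma order1_coefsM f g : order1_coefs f -> order1_coefs (f * g).
Proof.
move=> lf i; rewrite coefM; apply: order_ge_sum => j _.
by apply: (@order_geM 1 0); [apply: lf | apply: order_ge_any].
Qed.

Lemma order1_coefsC c : order_ge 1 c -> order1_coefs c%:P.
Proof. by move=> lc i; rewrite coefC; case: ifP => // _; apply: order_ge0. Qed.

Lemma order_ge_U (G : rgraph) : order_ge 1 (U G).
Proof. by rewrite -star_rooted_U; apply: order_ge_star1. Qed.

Lemma order1_coefs_cdot n (G H : rgraph) :
  order1_coefs (rooted_U G - 'X^n) -> order1_coefs (rooted_U H - 'X^n) ->
  order1_coefs (rooted_U (cdot G H) - 'X^((n + n).+1)).
Proof.
move=> lG lH; rewrite rooted_U_cdot.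
have -> : rooted_U G * ('X * rooted_U H + (U H)%:P) - 'X^((n + n).+1) =
    (rooted_U G - 'X^n) * ('X * 'X^n) +
    ((rooted_U H - 'X^n) * ('X * rooted_U G) + (U H)%:P * rooted_U G).
  by rewrite exprS exprD; apply: cdot_minus_top.
apply: order1_coefsD; first exact: order1_coefsM.
by apply: order1_coefsD; apply: order1_coefsM => //; apply/order1_coefsC/order_ge_U.
Qed.

(** Only the full edge set of a tree has no component away from the root, hence
    up to terms of positive degree in the x_i the rooted polynomial is a power
    of X.  The exponent is positive: a tree with one vertex would contribute
    x_1, which the specialization kills. *)
Lemma rooted_U_top k :
  exists2 n, (0 < n)%N &
  order1_coefs (rooted_U (A_ k) - 'X^n) /\ order1_coefs (rooted_U (B_ k) - 'X^n).
Proof.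
elim: k => [|k [n n_gt0 [lA lB]]]; last first.
  by exists (n + n).+1; rewrite //= ; split; apply: order1_coefs_cdot.
exists 2 => //; rewrite rooted_U_A0 rooted_U_B0; split.
  have -> : ('X + (x_ 1)%:P) * ('X + (x_ 1)%:P) - 'X^2 =
            (x_ 1)%:P * ('X + ('X + (x_ 1)%:P)) by apply: center_minus_top.
  exact/order1_coefsM/order1_coefsC/order_ge_x.
have -> : 'X * ('X + (x_ 1)%:P) + (x_ 2 + x_ 1 * x_ 1)%:P - 'X^2 =
          (x_ 1)%:P * 'X + (x_ 2 + x_ 1 * x_ 1)%:P by apply: leaf_minus_top.
apply: order1_coefsD; first exact/order1_coefsM/order1_coefsC/order_ge_x.
apply/order1_coefsC/order_geD; first exact: order_ge_x.
by apply: (@order_geM 1 0); [apply: order_ge_x | apply: order_ge_any].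
Qed.

Lemma monic_order_U k : monic_order 1 (specialize (U (A_ k))).
Proof.
have [n n_gt0 [top _]] := rooted_U_top k.
have : order_ge 2 (star (rooted_U (A_ k) - 'X^n)) by apply: order_ge_star.
rewrite starB starXn star_rooted_U => /specialize_order_ge[w].
rewrite rmorphB specialize_x eqSS (gtn_eqF n_gt0) => /eqP; rewrite subr_eq => /eqP ->.
exists (1 + 'X * w); last by rewrite hornerD hornerM hornerX hornerC mul0r addr0.
by rewrite mulrDr mulr1 addrC mulrA -expr2.
Qed.

(** * The order of the difference *)

Lemma star_deltaM f : star (delta * f) = x_ 1 * star ('X * f) - x_ 2 * star f.
Proof.
by rewrite /delta mulrBl starB -scalerAl starZ mul_polyC starZ.
Qed.

(** [delta] compares two rootings of the same path, which [star] forgets. *)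
Lemma star_delta : star delta = 0.
Proof.
rewrite /delta starB starZ starX star_polyC; apply/eqP; rewrite subr_eq0; apply/eqP.
exact: mulrC.
Qed.

Lemma specialize_star_delta f :
  specialize (star (delta * f)) = - ('X * specialize (star f)).
Proof.
apply: etrans (congr1 specialize (star_deltaM f)) _.
apply: rmorph_prodB; exact: specialize_x.
Qed.

Lemma specialize_star_delta2 : specialize (star (delta * delta)) = 0.
Proof. by rewrite specialize_star_delta star_delta rmorph0 mulr0 oppr0. Qed.

Lemma order_ge_star_delta f : order_ge 2 (star (delta * f)).
Proof.
by rewrite star_deltaM; apply: order_geB; apply: (@order_geM 1 1);
  [apply: order_ge_x | apply: order_ge_star1
  |apply: order_ge_x | apply: order_ge_star1].
Qed.

(** One better than the bound for a general factor: as star delta = 0, only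
    x_1 star (X delta) is left, where [delta] occurs once more. *)
Lemma order_ge_star_delta_delta : order_ge 3 (star (delta * delta)).
Proof.
have -> : star (delta * delta) = x_ 1 * star (delta * 'X).
  rewrite [delta * 'X]mulrC; apply: etrans (star_deltaM delta) _.
  exact: subr_mulr0 star_delta.
by apply: (@order_geM 1 2); [apply: order_ge_x | apply: order_ge_star_delta].
Qed.

Lemma order_ge_U_YZ k l : order_ge (k + l + 4) (U (Y k l) - U (Z k l)).
Proof.
rewrite U_YZ; apply: order_geM.
  apply: order_geM; apply: (order_ge_prod (F := fun i => U (A_ i))) => i;
    exact: order_ge_U.
apply: order_geB.
  by apply: (@order_geM 3 1);
    [apply: order_ge_star_delta_delta | apply: order_ge_star1].
by apply: (@order_geM 2 2); apply: order_ge_star_delta.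
Qed.

(** The product of order k + l + 4 is that of the P_i, i < k or i < l, of P_k,
    of P_l and of t^2. *)
Lemma specialize_U_YZ k l :
  monic_order (k + l + 4) (- specialize (U (Y k l) - U (Z k l))).
Proof.
have evB i : specialize (star (rooted_U (B_ i))) = specialize (U (A_ i))
  by rewrite star_rooted_U U_B_eq_A.
have -> : - specialize (U (Y k l) - U (Z k l)) =
    (\prod_(i < k) specialize (U (A_ i))) * (\prod_(i < l) specialize (U (A_ i))) *
    ('X * specialize (U (A_ k)) * ('X * specialize (U (A_ l)))).
  rewrite U_YZ; apply: rmorph_exchange; rewrite ?rmorph_prod //.
  - exact: specialize_star_delta2.
  - by rewrite specialize_star_delta evB.
  - by rewrite specialize_star_delta evB.
have oU := monic_order_U.
apply: monic_orderM; last first.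
  by apply: (@monic_orderM 2 2); apply: (@monic_orderM 1 1) => //; apply: monic_orderX.
by apply: monic_orderM; apply: (@monic_order_prod _ (fun i => specialize (U (A_ i)))).
Qed.

Local Close Scope ring_scope.

Theorem theorem12 (k l : nat) :
  ~ isomorphic (Y k l) (Z k l) /\
  Utrunc (k + l + 2) (Y k l) = Utrunc (k + l + 2) (Z k l) /\
  Utrunc (k + l + 3) (Y k l) <> Utrunc (k + l + 3) (Z k l).
Proof.
have ne : Utrunc (k + l + 3) (Y k l) <> Utrunc (k + l + 3) (Z k l).
  move=> /truncate_eq; rewrite -addnS => /specialize_order_ge[w e].
  apply: (@monic_order_exact _ _ (- w)%R (specialize_U_YZ k l)).
  by rewrite e mulrN addnS.
split; first by move=> /U_iso e; apply: ne; rewrite /Utrunc e.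
split; last exact: ne.
apply/truncate_eq; rewrite -!addnS; exact: order_ge_U_YZ.
Qed.
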